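(* Let $\mathcal{U}$ be a soft $\mathrm{UPE}(D{:}R|Z;E)$ for $\mathcal{H}$, let $\sigma$ be a positive integer, $\epsilon>0$, and let $\mathcal{E}$ be a linear strong extractor. Then the protocol $\mathcal{Q}(\sigma,\epsilon;\mathcal{U})$ described in the context, used with $\mathcal{E}$, is a $(\sigma,\epsilon)$-sound randomness generation protocol with respect to $ZE$ and $\mathcal{H}$.
   Context: All random variables (RVs) have finite value spaces; $\mathrm{Rng}(X)$ is the value space of $X$. Juxtaposition denotes joint RVs and values. $R,Z,E$ are RVs, $D$ is a function of $R$, and $\mathcal{H}$ is a set (model) of joint distributions of $R,Z,E$. $\mu[X|\phi]$ is the distribution of $X$ conditional on $\phi$; conditions involving conditional probabilities are only required for conditioning values of positive probability. $\mathrm{TV}(\nu,\nu')=\frac12\sum_x|\nu(x)-\nu'(x)|$; $\mathrm{Unif}_X$ is uniform on $\mathrm{Rng}(X)$. A subprobability distribution is a non-negative function $\tilde\nu$ with weight $w(\tilde\nu)=\sum_x\tilde\nu(x)\le 1$. Soft UPE: for $0\le\epsilon'\le1$, a function $F:\mathrm{Rng}(RZ)\to[0,\infty)$ is an $\epsilon'$-soft $\mathrm{UPE}(D{:}R|Z;E,\mathcal{H})$ if for all values $e$ of $E$ and all $\mu\in\mathcal{H}$: (1) there exist subprobability distributions $\tilde\mu_z\le\mu[DR|ze]$ of $DR$ with $\sum_z w(\tilde\mu_z)\mu(z|e)\ge 1-\epsilon'$; (2) there exists a non-negative function $q(r|dz)$ with $\sum_r q(r|dz)=1$ for all $dz$,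 such that $\tilde\mu_z(dr)\le F(rz)\,q(r|dz)$ for all $d,r,z$. A function $\mathcal{U}:\mathrm{Rng}(RZ)\times[0,1]\to[0,\infty)$ is a soft UPE if it is monotone non-decreasing in the second argument and for each $\epsilon'$, $\mathcal{U}(RZ,1-\epsilon')$ is an $\epsilon'$-soft UPE. Strong extractor: a family of functions $\mathcal{E}(\cdot,\cdot;\tau,\sigma,\epsilon_x):\{0,1\}^n\times\{0,1\}^l\to\{0,1\}^\sigma$ together with a set of admissible parameter tuples $(n,l,\tau,\sigma,\epsilon_x)$ (those that ''satisfy the extractor constraints''; these always include $\tau\le n$, $1\le\sigma\le\tau$, $0<\epsilon_x\le1$), such that for each admissible tuple, if $D$ is any $n$-bit RV with $\max_{d}\mathbb{P}(D=d)\le2^{-\tau}$ and $S$ is a uniform $l$-bit string independent of $D$, then the joint distribution of $\mathcal{E}(D,S;\tau,\sigma,\epsilon_x)S$ is within TV distance $\epsilon_x$ of uniform. The extractor is linear if for each seed value $s$ the map $d\mapsto\mathcal{E}(d,s;\tau,\sigma,\epsilon_x)$ is linear over the two-element field (each output bit is a parity of bits of $d$). Available randomness: a source $S$ of uniform random bits independent of all other RVs; $(s)_{\le l}$ denotes the length-$l$ prefix. Protocol $\mathcal{Q}(\sigma,\epsilon;\mathcal{U})$: (0) Choose (before and independently of $R,Z,S$) $n$, $\sigma_h$, $\epsilon_h>0$, $\epsilon_x>0$ and $l$ such that $(n,l,-\log_2(2^{-\sigma_h}+2^{-n}),\sigma,\epsilon_x)$ satisfies the extractor constraints, $\epsilon_h+\epsilon_x=\epsilon$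 and $2^{-n}\le2^{-\sigma_h}$. (1) Perform trials to obtain values $r,z$ of $R,Z$ expressed as bit strings, with $|D|=n$; let $d$ be the value of $D$. (2) Determine $F(rz)=\mathcal{U}(rz,1-\epsilon_h)$. (3) If $F(rz)>2^{-\sigma_h}$, return with $\mathcal{Q}_X$ and $\mathcal{Q}_S$ the empty strings and $\mathcal{Q}_P=0$ (failure). (4) Otherwise obtain the value $(s)_{\le l}$ of $S_{\le l}$. (5) Output $\mathcal{Q}_X=\mathcal{E}(d,(s)_{\le l};-\log_2(2^{-\sigma_h}+2^{-n}),\sigma,\epsilon_x)$, $\mathcal{Q}_S=(s)_{\le l}$ and $\mathcal{Q}_P=1$. Soundness: the protocol is $(\sigma,\epsilon)$-sound with respect to $E'$ and $\mathcal{H}$ if for all $\mu\in\mathcal{H}$, $|\mathcal{Q}_X|=\sigma$ (on success) and there is a distribution $\nu_{E'}$ of $E'$ such that $\mathrm{TV}(\mu[\mathcal{Q}_X\mathcal{Q}_SE'|\mathcal{Q}_P=1],\mathrm{Unif}\otimes\mathrm{Unif}\otimes\nu_{E'})\,\mathbb{P}_\mu(\mathcal{Q}_P=1)\le\epsilon$, where the two uniform distributions are on $\{0,1\}^\sigma$ and on $\{0,1\}^l$ (the distribution of the seed), and the left side is read as $0$ if $\mathbb{P}_\mu(\mathcal{Q}_P=1)=0$. *)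

(* Defs.v *)
From HB Require Import structures.
From mathcomp Require Export all_boot all_order all_algebra.
From mathcomp Require Export interval_inference classical_sets reals exp.

Set Implicit Arguments.
Unset Strict Implicit.
Unset Printing Implicit Defensive.

Import Order.TTheory GRing.Theory Num.Theory.
Local Open Scope ring_scope.

Record fdist (K : realType) (T : finType) := FDist {
  pmf :> T -> K;
  pmf_ge0 : forall x, 0 <= pmf x;
  pmf_sum1 : \sum_x pmf x = 1 }.

Definition weight (K : realType) (T : finType) (p : T -> K) : K :=
  \sum_x p x.

Definition subdist (K : realType) (T : finType) (p : T -> K) : Prop :=
  (forall x, 0 <= p x) /\ weight p <= 1.

Definition TV (K : realType) (T : finType) (p q : T -> K) : K :=
  2^-1 * \sum_x `|p x - q x|.

Definition unif (K : realType) (T : finType) : T -> K := fun=> #|T|%:R^-1.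
Arguments unif : clear implicits.

(* The independent joint law p (x) q on a product of finite value spaces. *)
Definition indep (K : realType) (A B : finType) (p : A -> K) (q : B -> K) :
  A * B -> K := fun w => p w.1 * q w.2.

Definition Prob (K : realType) (W : finType) (p : W -> K) (A : pred W) : K :=
  \sum_(w | A w) p w.

Definition law (K : realType) (W T : finType) (p : W -> K) (X : W -> T) :
  T -> K := fun x => Prob p (fun w => X w == x).

(* p[X | A]; identically 0 when A has probability 0, since x / 0 = 0. *)
Definition claw (K : realType) (W T : finType) (p : W -> K) (X : W -> T)
  (A : pred W) : T -> K :=
  fun x => Prob p (fun w => (X w == x) && A w) / Prob p A.

(* The sample space carrying R, Z, E is Rng(R) x Rng(Z) x Rng(E). *)
Definition rvR (TR TZ TE : finType) (w : TR * TZ * TE) : TR := w.1.1.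
Definition rvZ (TR TZ TE : finType) (w : TR * TZ * TE) : TZ := w.1.2.
Definition rvE (TR TZ TE : finType) (w : TR * TZ * TE) : TE := w.2.

(* F is an eps'-soft UPE(D:R|Z;E,H).  The value D of the function D of R is
   kept explicit in the law of DR. *)
Definition is_soft_UPE (K : realType) (TD TR TZ TE : finType) (D : TR -> TD)
    (H : set (fdist K (TR * TZ * TE)%type)) (eps' : {i01 K})
    (F : TR -> TZ -> {nonneg K}) : Prop :=
  forall (e : TE) (mu : fdist K (TR * TZ * TE)%type), H mu ->
  0 < Prob mu (fun w => rvE w == e) ->
  exists mut : TZ -> TD * TR -> K,
  [/\ forall z, subdist (mut z),
      forall z, 0 < Prob mu (fun w => (rvZ w == z) && (rvE w == e)) ->
        forall x, mut z x <=
          claw mu (fun w => (D (rvR w), rvR w))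
                  (fun w => (rvZ w == z) && (rvE w == e)) x,
      1 - eps'%:num <=
        \sum_z weight (mut z) * claw mu (@rvZ _ _ _) (fun w => rvE w == e) z
    & exists q : TD -> TZ -> fdist K TR,
        forall d r z, mut z (d, r) <= (F r z)%:num * q d z r].

Definition soft_UPE (K : realType) (TD TR TZ TE : finType) (D : TR -> TD)
    (H : set (fdist K (TR * TZ * TE)%type))
    (U : TR -> TZ -> {i01 K} -> {nonneg K}) : Prop :=
  (forall r z (a b : {i01 K}), a%:num <= b%:num ->
     (U r z a)%:num <= (U r z b)%:num) /\
  (forall eps' : {i01 K},
     is_soft_UPE D H eps' (fun r z => U r z (1 - eps'%:num)%:i01)).

(* {0,1}^n, with the two-element field as the set of bits. *)
Notation bits n := 'rV['F_2]_n.

Record strong_extractor (K : realType) := StrongExtractor {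
  ext :> forall (n l : nat) (tau : K) (sigma : nat) (epsx : K),
    bits n -> bits l -> bits sigma;
  ext_constraints : nat -> nat -> K -> nat -> K -> Prop;
  ext_bounds : forall n l tau sigma epsx,
    ext_constraints n l tau sigma epsx ->
    [/\ tau <= n%:R, (1 <= sigma)%N, sigma%:R <= tau & 0 < epsx <= 1];
  ext_strong : forall n l tau sigma epsx,
    ext_constraints n l tau sigma epsx ->
    forall pD : fdist K (bits n), (forall d, pD d <= 2 `^ (- tau)) ->
    TV (law (indep pD (unif K (bits l)))
            (fun w => (@ext n l tau sigma epsx w.1 w.2, w.2)))
       (unif K (bits sigma * bits l)%type) <= epsx }.

Arguments ext {K} _ n l tau sigma epsx _ _.

Definition linear_extractor (K : realType) (Ext : strong_extractor K) : Prop :=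
  forall n l tau sigma epsx, ext_constraints Ext n l tau sigma epsx ->
  forall s : bits l,
    linear (fun d : bits n => Ext n l tau sigma epsx d s).

Definition log2 (K : realType) (x : K) : K := ln x / ln 2.

Definition Qtau (K : realType) (n : nat) (sigmah : K) : K :=
  - log2 (2 `^ (- sigmah) + 2 `^ (- n%:R)).

(* epsh lies in [0,1] because U(.,1 - epsh) is only defined there. *)
Definition Qparams (K : realType) (Ext : strong_extractor K) (n sigma : nat)
    (eps sigmah : K) (epsh : {i01 K}) (epsx : K) (l : nat) : Prop :=
  [/\ 0 < epsh%:num, 0 < epsx,
      ext_constraints Ext n l (Qtau n sigmah) sigma epsx,
      epsh%:num + epsx = eps
    & 2 `^ (- n%:R) <= 2 `^ (- sigmah)].

(* Outputs may have variable length (empty on failure), hence bounded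
   sequences. *)
Record output (sigma l : nat) := Output {
  outX : sigma.-bseq 'F_2;
  outS : l.-bseq 'F_2;
  outP : bool }.

Definition string_of (k : nat) (v : bits k) : k.-bseq 'F_2 :=
  bseq_of_tuple [tuple v 0 i | i < k].

(* The uniform law on {0,1}^k, as a law on strings of length at most k. *)
Definition unif_string (K : realType) (k : nat) : k.-bseq 'F_2 -> K :=
  fun x => if size x == k then (2 ^+ k)^-1 else 0.
Arguments unif_string : clear implicits.

(* (s)_{<= l} for a source delivering L bits. *)
Definition prefix_bits (L l : nat) (lL : (l <= L)%N) (s : bits L) : bits l :=
  colsub (widen_ord lL) s.

Definition protocolQ (K : realType) (TR TZ : finType) (n : nat)
    (D : TR -> bits n) (U : TR -> TZ -> {i01 K} -> {nonneg K})
    (Ext : strong_extractor K) (sigma : nat) (sigmah : K) (epsh : {i01 K})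
    (epsx : K) (l L : nat) (lL : (l <= L)%N)
    (r : TR) (z : TZ) (s : bits L) : output sigma l :=
  let F := (U r z (1 - epsh%:num)%:i01)%:num in
  if 2 `^ (- sigmah) < F then Output [bseq] [bseq] false
  else Output
    (string_of (Ext n l (Qtau n sigmah) sigma epsx (D r) (prefix_bits lL s)))
    (string_of (prefix_bits lL s)) true.

(* (sigma,eps)-soundness of a protocol Q with respect to E' and H.  The trial
   results and the L source bits are distributed as mu (x) Unif.  When success
   has probability 0 the left side of the inequality is 0. *)
Definition sound (K : realType) (TR TZ TE TE' : finType)
    (H : set (fdist K (TR * TZ * TE)%type)) (E' : TR * TZ * TE -> TE')
    (sigma : nat) (eps : K) (l L : nat)
    (Q : TR -> TZ -> bits L -> output sigma l) : Prop :=
  let run (w : TR * TZ * TE * bits L) := Q (rvR w.1) (rvZ w.1) w.2 in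
  let success (w : TR * TZ * TE * bits L) := outP (run w) in
  forall mu : fdist K (TR * TZ * TE)%type, H mu ->
  let P := indep mu (unif K (bits L)) in
  (forall w, success w -> size (outX (run w)) = sigma) /\
  exists nu : fdist K TE',
    TV (claw P (fun w => (outX (run w), outS (run w), E' w.1)) success)
       (indep (indep (unif_string K sigma) (unif_string K l)) nu)
    * Prob P success <= eps.

(* Main.v *)
Require Import Defs.
From mathcomp Require Import ring lra.

Set Implicit Arguments.
Unset Strict Implicit.
Unset Printing Implicit Defensive.

Import Order.TTheory GRing.Theory Num.Theory.
Local Open Scope ring_scope.

(* Fix e and restrict the law to success, F(rz) <= 2^-sigmah.  By the soft UPE
   property the law of D given ze on this event dominates, up to a total mass of
   epsh over z, a subdistribution with max-probability at most 2^-sigmah.  The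
   strong extractor only handles genuine distributions, so the missing mass is
   filled with the uniform law, which adds at most 2^-n to the max-probability.
   A linear map sends the uniform law to the uniform law of a subspace, so the
   distance of the extractor output of the subdistribution from the uniform law
   scaled to the same weight is at most that of the padded one, i.e. epsx.
   The witness nu is the law of ZE conditional on success. *)

(** * Laws and total variation distance for unnormalised measures *)

Section Laws.
Variable K : realType.
Implicit Types W T A B : finType.

(** Left unnormalised, so that conditioning on success needs no division by its probability; [clawM]
    is the link with [claw]. *)
Definition restrict W (p : W -> K) (A : pred W) : W -> K :=
  fun w => if A w then p w else 0.

Lemma restrict_ge0 W (p : W -> K) (A : pred W) :
  (forall w, 0 <= p w) -> forall w, 0 <= restrict p A w.
Proof. by move=> p0 w; rewrite /restrict; case: ifP. Qed.

Lemma sum_restrict W (p : W -> K) (A : pred W) : \sum_w restrict p A w = Prob p A.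
Proof. by rewrite /Prob [RHS]big_mkcond. Qed.

Lemma law_restrict W T (p : W -> K) (A : pred W) (X : W -> T) x :
  law (restrict p A) X x = Prob p (fun w => (X w == x) && A w).
Proof. by rewrite /law /Prob -big_mkcondr. Qed.

Lemma Prob_ge0 W (p : W -> K) (A : pred W) :
  (forall w, 0 <= p w) -> 0 <= Prob p A.
Proof. by move=> p0; apply: sumr_ge0. Qed.

Lemma law_ge0 W T (p : W -> K) (X : W -> T) :
  (forall w, 0 <= p w) -> forall x, 0 <= law p X x.
Proof. by move=> p0 x; apply: Prob_ge0. Qed.

Lemma law_comp W T A (p : W -> K) (X : W -> T) (f : T -> A) a :
  law (law p X) f a = law p (f \o X) a.
Proof.
rewrite /law /Prob [RHS](partition_big X (fun y => f y == a)) //=.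
apply: eq_bigr => y /eqP fy; apply: eq_bigl => w.
by have [->|] := eqVneq (X w) y; rewrite ?andbF // fy eqxx.
Qed.

Lemma law_id T (p : T -> K) : law p id =1 p.
Proof. by move=> x; rewrite /law /Prob big_pred1_eq. Qed.

Lemma sum_law W T (p : W -> K) (X : W -> T) : \sum_x law p X x = \sum_w p w.
Proof. by rewrite /law /Prob [RHS](partition_big X xpredT). Qed.

Lemma eq_law W T (p q : W -> K) (X Y : W -> T) :
  p =1 q -> X =1 Y -> law p X =1 law q Y.
Proof.
by move=> pq XY x; apply: eq_big => [w|w _]; rewrite ?XY ?pq.
Qed.

Lemma lawB W T (p q : W -> K) (X : W -> T) x :
  law (fun w => p w - q w) X x = law p X x - law q X x.
Proof. exact: sumrB. Qed.

Lemma lawD W T (p q : W -> K) (X : W -> T) x :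
  law (fun w => p w + q w) X x = law p X x + law q X x.
Proof. exact: big_split. Qed.

Lemma lawZ W T (a : K) (p : W -> K) (X : W -> T) x :
  law (fun w => a * p w) X x = a * law p X x.
Proof. by rewrite /law /Prob mulr_sumr. Qed.

Lemma law_indep_pair A B T (p : A -> K) (q : B -> K) (f : A -> B -> T) x b :
  law (indep p q) (fun w => (f w.1 w.2, w.2)) (x, b) =
  law p (f^~ b) x * q b.
Proof.
rewrite /law /Prob /indep mulr_suml.
rewrite -(pair_big_dep xpredT (fun a b' => (f a b', b') == (x, b))
  (fun a b' => p a * q b')) /=.
rewrite [RHS]big_mkcond /=; apply: eq_bigr => a _.
transitivity (\sum_(b' | b' == b) if f a b' == x then p a * q b' else 0).
  by rewrite -big_mkcondr; apply: eq_bigl => b'; rewrite xpair_eqE andbC.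
by rewrite big_pred1_eq.
Qed.

Lemma law_indep A B A' B' (p : A -> K) (q : B -> K) (f : A -> A') (g : B -> B') :
  law (indep p q) (fun w => (f w.1, g w.2)) =1 indep (law p f) (law q g).
Proof.
case=> a b; rewrite /law /Prob /indep /= mulr_suml.
under [RHS]eq_bigr do rewrite mulr_sumr.
by rewrite pair_big; apply: eq_bigl => w; rewrite xpair_eqE.
Qed.

(** Data processing: the triangle inequality is applied within each fibre of [f]. *)
Lemma TV_law_le W T (p q : W -> K) (f : W -> T) :
  TV (law p f) (law q f) <= TV p q.
Proof.
rewrite /TV ler_wpM2l ?invr_ge0 ?ler0n //.
rewrite -(sum_law (fun w => `|p w - q w|) f); apply: ler_sum => x _.
by rewrite -lawB /law /Prob; apply: ler_norm_sum.
Qed.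

Lemma eq_TV T (p p' q q' : T -> K) : p =1 p' -> q =1 q' -> TV p q = TV p' q'.
Proof.
by move=> pp qq; rewrite /TV; congr (_ * _); apply: eq_bigr => x _; rewrite pp qq.
Qed.

Lemma TVZr T (p q : T -> K) (k : K) : 0 <= k ->
  TV p q * k = TV (fun x => p x * k) (fun x => q x * k).
Proof.
move=> k0; rewrite /TV -mulrA mulr_suml; congr (_ * _).
by apply: eq_bigr => x _; rewrite -mulrBl normrM (ger0_norm k0).
Qed.

Lemma sum_unif T : (0 < #|T|)%N -> \sum_x unif K T x = 1.
Proof.
by move=> T0; rewrite /unif sumr_const -[LHS]mulr_natl divff // pnatr_eq0 -lt0n.
Qed.

Lemma unif_indep A B : unif K (A * B)%type =1 indep (unif K A) (unif K B).
Proof. by case=> a b; rewrite /unif /indep card_prod natrM invfM. Qed.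

Lemma sum_indep A B (p : A -> K) (q : B -> K) :
  \sum_w indep p q w = (\sum_a p a) * \sum_b q b.
Proof. by rewrite big_distrlr /= pair_bigA. Qed.

Lemma law_unif A B (f : A -> B) b :
  law (unif K A) f b = #|[pred a | f a == b]|%:R / #|A|%:R.
Proof. by rewrite /law /Prob /unif sumr_const -[LHS]mulr_natl. Qed.

Lemma sum_Prob W T (p : W -> K) (X : W -> T) (A : pred W) :
  \sum_x Prob p (fun w => (X w == x) && A w) = Prob p A.
Proof.
by under eq_bigr do rewrite -law_restrict; rewrite sum_law sum_restrict.
Qed.

Lemma Prob_le W (p : W -> K) (A B : pred W) : (forall w, 0 <= p w) ->
  (forall w, A w -> B w) -> Prob p A <= Prob p B.
Proof.
move=> p0 AB; rewrite /Prob [leLHS]big_mkcond [leRHS]big_mkcond /=.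
by apply: ler_sum => w _; have := AB w; case: (A w); case: (B w) => // /(_ isT).
Qed.

Lemma eq_Prob W (p : W -> K) (A B : pred W) : A =1 B -> Prob p A = Prob p B.
Proof. exact: eq_bigl. Qed.

(** Lets the output on failure be ignored, where the restricted measure vanishes. *)
Lemma eq_law_support W T (p q : W -> K) (X Y : W -> T) :
  p =1 q -> (forall w, q w != 0 -> X w = Y w) -> law p X =1 law q Y.
Proof.
move=> pq XY x; rewrite /law /Prob [LHS]big_mkcond [RHS]big_mkcond /=.
apply: eq_bigr => w _; rewrite pq; have [->|qw] := eqVneq (q w) 0.
  by rewrite !if_same.
by rewrite XY.
Qed.

Lemma TV_triangle T (p q r : T -> K) : TV p r <= TV p q + TV q r.
Proof.
rewrite /TV -mulrDr ler_wpM2l ?invr_ge0 ?ler0n // -big_split /=.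
by apply: ler_sum => x _; apply: ler_distD.
Qed.

Lemma TV_indep A B (p q : A -> K) (u : B -> K) : (forall b, 0 <= u b) ->
  TV (indep p u) (indep q u) = TV p q * \sum_b u b.
Proof.
move=> u0; rewrite /TV -mulrA; congr (_ * _); rewrite -sum_indep.
by apply: eq_bigr => w _; rewrite /indep -mulrBl normrM [`|u _|]ger0_norm.
Qed.

Lemma TV_le T (p q : T -> K) : (forall x, q x <= p x) ->
  TV p q = 2^-1 * (weight p - weight q).
Proof.
move=> qp; rewrite /TV /weight -sumrB; congr (_ * _).
by apply: eq_bigr => x _; rewrite ger0_norm // subr_ge0.
Qed.

(** Splits the distance along side information such as [(z, e)], without normalising the slices. *)
Lemma TV_prod A B (p q : A * B -> K) :
  TV p q = \sum_b TV (fun a => p (a, b)) (fun a => q (a, b)).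
Proof.
rewrite /TV -mulr_sumr; congr (_ * _).
by rewrite exchange_big /= pair_bigA; apply: eq_bigr => -[].
Qed.

Lemma claw_sum1 W T (p : W -> K) (X : W -> T) (A : pred W) :
  Prob p A != 0 -> \sum_x claw p X A x = 1.
Proof. by move=> pA; rewrite -mulr_suml sum_Prob divff. Qed.

Lemma claw_ge0 W T (p : W -> K) (X : W -> T) (A : pred W) :
  (forall w, 0 <= p w) -> forall x, 0 <= claw p X A x.
Proof. by move=> p0 x; rewrite divr_ge0 ?Prob_ge0. Qed.

Lemma clawM W T (p : W -> K) (X : W -> T) (A : pred W) x :
  Prob p A != 0 -> claw p X A x * Prob p A = law (restrict p A) X x.
Proof. by move=> pA; rewrite /claw divfK // law_restrict. Qed.

End Laws.

(** * Images of uniform laws under homomorphisms of finite abelian groups *)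

Section AdditiveFibers.
Variables (K : realType) (A B : finZmodType) (f : A -> B).
Hypothesis fB : {morph f : x y / x - y}.

(** Translation by [a] maps the kernel bijectively onto the fibre through [a]. *)
Lemma card_fiber (a : A) :
  #|[pred a' | f a' == f a]| = #|[pred a' | f a' == 0]|.
Proof.
have fD x : f (x + a) = f x + f a by rewrite -[X in f X + _](addrK a) fB subrK.
rewrite -!sum1_card (reindex_inj (addIr a)) /=; apply: eq_bigl => x.
by rewrite !inE fD -subr_eq0 addrK.
Qed.

(** There are [#|B|] fibres, each empty or of the size of the kernel, so [#|A|] is at most [#|B|]
    times that size. *)
Lemma law_unif_ge (a : A) : unif K B (f a) <= law (unif K A) f (f a).
Proof.
rewrite law_unif card_fiber /unif.
have A0 : (0 < #|A|)%N by apply/card_gt0P; exists 0.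
have B0 : (0 < #|B|)%N by apply/card_gt0P; exists 0.
rewrite ler_pdivlMr ?ltr0n // ler_pdivrMl ?ltr0n // -natrM ler_nat.
rewrite -sum1_card (partition_big f xpredT) //= -sum_nat_const.
apply: leq_sum => b _; rewrite sum1_card.
have [->//|/card_gt0P[a']] := posnP #|[pred a | f a == b]|.
by rewrite inE => /eqP <-; rewrite card_fiber.
Qed.

(** The pointwise bound of [law_unif_ge] between two laws of total mass 1 forces equality. *)
Lemma law_unif_surj : (forall b, exists a, f a = b) ->
  law (unif K A) f =1 unif K B.
Proof.
move=> surj b0.
have le b : unif K B b <= law (unif K A) f b.
  by have [a <-] := surj b; apply: law_unif_ge.
have : \sum_b (law (unif K A) f b - unif K B b) = 0.
  rewrite sumrB sum_law !sum_unif ?subrr //; apply/card_gt0P; by exists 0.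
move/eqP; rewrite psumr_eq0 => [|b _]; last by rewrite subr_ge0.
by move/allP/(_ b0 (mem_index_enum _)); rewrite subr_eq0 => /eqP.
Qed.

(* Termwise |P - w u| <= |P + (1-w) U - u| + (1-w)(U - u), where P, U, u are the
   image of p, the image of the uniform law, and the uniform law: on the range of
   f this uses u <= U, off the range P = U = 0.  The corrections sum to 0. *)
Lemma law_pad_unif (p : A -> K) : (forall a, 0 <= p a) -> weight p <= 1 ->
  \sum_b `|law p f b - weight p * unif K B b| <=
  \sum_b `|law (fun a => p a + (1 - weight p) * unif K A a) f b - unif K B b|.
Proof.
move=> p0 w1; set w := weight p.
have -> : \sum_b `|law (fun a => p a + (1 - w) * unif K A a) f b - unif K B b|
  = \sum_b (`|law (fun a => p a + (1 - w) * unif K A a) f b - unif K B b|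
      + (1 - w) * (law (unif K A) f b - unif K B b)).
  rewrite big_split /= -mulr_sumr sumrB sum_law !sum_unif ?subrr ?mulr0 ?addr0 //;
  apply/card_gt0P; by exists 0.
apply: ler_sum => b _; rewrite lawD lawZ.
have u0 : 0 <= unif K B b by rewrite invr_ge0 ler0n.
have [/existsP[a /eqP fa]|/existsPn nf] := boolP [exists a, f a == b].
  have := law_unif_ge a; rewrite fa => le.
  set P := law p f b; set U := law _ f b; set u := unif K B b.
  have -> : P - w * u = (P + (1 - w) * U - u) - (1 - w) * (U - u) by ring.
  apply: (le_trans (ler_normB _ _)); rewrite lerD2l ger0_norm //.
  by apply: mulr_ge0; rewrite subr_ge0.
have empty q : law q f b = 0 :> K.
  by rewrite /law /Prob big_pred0 // => a; apply/negbTE.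
have w0 : 0 <= w by apply: sumr_ge0.
rewrite !empty mulr0 addr0 !sub0r !normrN !ger0_norm ?mulr_ge0 //.
by rewrite mulrN mulrBl opprB mul1r addrC subrK.
Qed.

End AdditiveFibers.

(** * Linear extractors on subprobability inputs *)

Section SubmeasureInput.
Variable K : realType.

Lemma card_bits n : #|{: bits n}| = (2 ^ n)%N.
Proof. by rewrite card_mx card_Fp // mul1n. Qed.

Lemma card_bits_gt0 n : (0 < #|{: bits n}|)%N.
Proof. by rewrite card_bits expn_gt0. Qed.

Lemma unif_bits n (d : bits n) : unif K (bits n) d = 2 `^ (- n%:R).
Proof. by rewrite /unif card_bits natrX -powR_mulrn // powRN. Qed.

(** The entropy parameter is chosen to make the extractor's max-probability bound exactly that of
    the padded input. *)
Lemma powR_Qtau n (sigmah : K) :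
  2 `^ (- Qtau n sigmah) = 2 `^ (- sigmah) + 2 `^ (- n%:R).
Proof.
have gt0 x : 0 < 2 `^ x :> K by rewrite powR_gt0.
rewrite {1}/powR (_ : 2 == 0 :> K = false) ?pnatr_eq0 // /Qtau opprK /log2.
rewrite divfK ?lnK ?posrE ?addr_gt0 //.
by rewrite gt_eqF // ln_gt0 // ltr1n.
Qed.

(** The seed is part of the output, so the distance is an average over seeds, and each fixed seed
    can be treated as a single linear map. *)
Lemma TV_seeded (A B S : finType) (p : A -> K) (f : A -> S -> B) (w : K) :
  TV (law (indep p (unif K S)) (fun t => (f t.1 t.2, t.2)))
     (fun t => w * unif K (B * S)%type t) =
  2^-1 * \sum_s (\sum_b `|law p (f^~ s) b - w * unif K B b|) * unif K S s.
Proof.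
rewrite /TV; congr (_ * _).
rewrite -(pair_bigA _ (fun b s => `|law (indep p (unif K S))
  (fun t => (f t.1 t.2, t.2)) (b, s) - w * unif K (B * S)%type (b, s)|)) /=.
rewrite exchange_big /=; apply: eq_bigr => s _; rewrite mulr_suml.
apply: eq_bigr => b _; rewrite law_indep_pair unif_indep /indep /= mulrA.
by rewrite -mulrBl normrM [`|unif K S s|]ger0_norm // invr_ge0 ler0n.
Qed.

Variable Ext : strong_extractor K.
Hypothesis hExt : linear_extractor Ext.
Variables (n l sigma : nat) (tau epsx : K).
Hypothesis cExt : ext_constraints Ext n l tau sigma epsx.

Lemma extract_subdist (p : bits n -> K) (b : K) : subdist p ->
  (forall d, p d <= b) -> b + 2 `^ (- n%:R) <= 2 `^ (- tau) ->
  TV (law (indep p (unif K (bits l))) (fun t => (Ext n l tau sigma epsx t.1 t.2, t.2)))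
     (fun t => weight p * unif K (bits sigma * bits l)%type t) <= epsx.
Proof.
move=> [p0 w1] pb hb; set w := weight p.
have w0 : 0 <= w by apply: sumr_ge0.
pose p' d := p d + (1 - w) * unif K (bits n) d.
have p'0 d : 0 <= p' d.
  by rewrite addr_ge0 // mulr_ge0 ?subr_ge0 // invr_ge0 ler0n.
have p'1 : \sum_d p' d = 1.
  by rewrite big_split /= -mulr_sumr sum_unif ?card_bits_gt0 // mulr1 addrC subrK.
have p'b d : FDist p'0 p'1 d <= 2 `^ (- tau).
  apply: le_trans hb; rewrite /= /p' lerD // unif_bits ler_piMl ?powR_ge0 //.
  by rewrite gerBl.
apply: le_trans (ext_strong cExt p'b).
(* The factor 1 is the weight of [p']; it gives the uniform term the shape required by
   [TV_seeded]. *)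
rewrite -[leRHS](eq_TV (p := law (indep p' (unif K (bits l)))
   (fun t => (Ext n l tau sigma epsx t.1 t.2, t.2)))
   (q := fun t => 1 * unif K (bits sigma * bits l)%type t)) //; last first.
  by move=> t; rewrite mul1r.
rewrite !TV_seeded ler_wpM2l ?invr_ge0 ?ler0n //.
apply: ler_sum => s _; rewrite ler_wpM2r ?invr_ge0 ?ler0n //.
under [X in _ <= X]eq_bigr do rewrite mul1r.
apply: law_pad_unif => // x y.
(* Linearity with scalar [-1] gives compatibility with differences. *)
by have := hExt cExt s (-1) y x; rewrite !scaleN1r [- y + x]addrC [RHS]addrC.
Qed.

(** Dividing by [M] reduces to [extract_subdist]. With [M] the probability of [ze], the errors are
    weighted so that they can be summed over [z]. *)
Lemma extract_submeasure (p : bits n -> K) (M b : K) :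
  (forall d, 0 <= p d) -> weight p <= M ->
  (forall d, p d <= M * b) -> b + 2 `^ (- n%:R) <= 2 `^ (- tau) ->
  TV (law (indep p (unif K (bits l))) (fun t => (Ext n l tau sigma epsx t.1 t.2, t.2)))
     (fun t => weight p * unif K (bits sigma * bits l)%type t) <= M * epsx.
Proof.
move=> p0 wM pb hb.
have M0 : 0 <= M by apply: le_trans wM; apply: sumr_ge0.
(* Rescaling is impossible for [M = 0], but then [p] vanishes and both measures are zero. *)
have [Mz|Mn0] := eqVneq M 0.
  have pz d : p d = 0 by apply/eqP; rewrite eq_le p0 andbT (le_trans (pb d)) // Mz mul0r.
  rewrite Mz mul0r /TV big1 ?mulr0 // => -[x s] _.
  by rewrite law_indep_pair /law /Prob /weight !big1 ?mul0r ?subr0 ?normr0.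
have Mp : 0 < M by rewrite lt_neqAle eq_sym Mn0.
pose p1 d := M^-1 * p d.
have wE : weight p = M * weight p1 by rewrite /weight -mulr_sumr mulVKf.
have sub1 : subdist p1.
  split=> [d|]; first by rewrite mulr_ge0 // invr_ge0.
  by rewrite -(ler_pM2l Mp) -wE mulr1.
have p1b d : p1 d <= b by rewrite /p1 ler_pdivrMl.
have := extract_subdist sub1 p1b hb; rewrite -(ler_pM2l Mp) mulrC TVZr //.
apply: le_trans; rewrite le_eqVlt; apply/orP; left; apply/eqP.
apply: eq_TV => -[x s]; last by rewrite wE; ring.
rewrite !law_indep_pair mulrAC [_ * M]mulrC -lawZ; congr (_ * _).
by apply: eq_law => // d; rewrite /p1 mulVKf.
Qed.

End SubmeasureInput.

(** * Bit vectors as strings, and prefixes of uniform bits *)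

Section Strings.
Variable K : realType.

Lemma size_string_of k (v : bits k) : size (string_of v) = k.
Proof. by rewrite size_tuple. Qed.

Lemma string_of_inj k : injective (@string_of k).
Proof.
move=> u v uv; apply/rowP => i.
have : nth 0 [tuple u 0 j | j < k] i = nth 0 [tuple v 0 j | j < k] i.
  have := congr1 (fun x : k.-bseq 'F_2 => nth 0 x i) uv => /= E; exact: E.
by rewrite !nth_mktuple.
Qed.

Lemma string_of_onto k (x : k.-bseq 'F_2) : size x = k ->
  exists v : bits k, string_of v = x.
Proof.
move=> xk; exists (\row_i nth 0 x i); apply/val_inj/(@eq_from_nth _ 0).
  by rewrite size_string_of xk.
move=> i; rewrite size_string_of => ik.
by rewrite -[i]/(val (Ordinal ik)) [LHS]nth_mktuple mxE.
Qed.

(** [string_of] is a bijection onto the strings of length exactly [k]; shorter strings have an empty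
    fibre. *)
Lemma law_string_of k : law (unif K (bits k)) (@string_of k) =1 unif_string K k.
Proof.
move=> x; rewrite law_unif /unif_string card_bits natrX.
case: eqP => [/string_of_onto[v <-]|xk].
  rewrite (eq_card (B := pred1 v)) ?card1 ?mul1r // => u.
  by rewrite !inE (inj_eq (@string_of_inj k)).
rewrite eq_card0 ?mul0r // => u; apply/negbTE/eqP => ux.
by apply: xk; rewrite -ux size_string_of.
Qed.

Lemma law_prefix_bits L l (lL : (l <= L)%N) :
  law (unif K (bits L)) (prefix_bits lL) =1 unif K (bits l).
Proof.
apply: law_unif_surj => [x y|v]; first by apply/rowP => i; rewrite !mxE.
(* A preimage pads [v] with zeros: [insub] fails from index [l] on. *)
exists (\row_(j < L) oapp (v 0) 0 (insub (val j))); apply/rowP => i.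
by rewrite !mxE /= valK.
Qed.

End Strings.

(** * From a soft UPE to a submeasure of bounded max-probability *)

Section SoftUPE.
Variables (K : realType) (TD TR TZ TE : finType) (D : TR -> TD).
Variables (H : set (fdist K (TR * TZ * TE)%type)) (F : TR -> TZ -> {nonneg K}).

Definition success_law (mu : TR * TZ * TE -> K) (b : K) (z : TZ) (e : TE) :
    TD -> K :=
  law (restrict mu (fun w => [&& (F (rvR w) (rvZ w))%:num <= b,
    rvZ w == z & rvE w == e])) (fun w => D (rvR w)).

Variables (mu : fdist K (TR * TZ * TE)%type) (b : K) (e : TE).

Let M z := Prob mu (fun w => (rvZ w == z) && (rvE w == e)).
Let J z x := Prob mu (fun w => ((D (rvR w), rvR w) == x) &&
  ((rvZ w == z) && (rvE w == e))).

Let M_ge0 z : 0 <= M z.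
Proof. exact/Prob_ge0/pmf_ge0. Qed.

Let sum_M : \sum_z M z = Prob mu (fun w => rvE w == e).
Proof. exact: sum_Prob. Qed.

Lemma weight_success_law z : weight (success_law mu b z e) =
  Prob mu (fun w => [&& (F (rvR w) (rvZ w))%:num <= b, rvZ w == z & rvE w == e]).
Proof. by rewrite /weight sum_law sum_restrict. Qed.

Lemma weight_success_law_le z : weight (success_law mu b z e) <=
  Prob mu (fun w => (rvZ w == z) && (rvE w == e)).
Proof.
rewrite weight_success_law; apply: Prob_le; first exact: pmf_ge0.
by move=> w /and3P[_ -> ->].
Qed.

Let success_lawE z d :
  success_law mu b z e d = \sum_(r | (F r z)%:num <= b) J z (d, r).
Proof.
rewrite /success_law law_restrict /Prob.
rewrite (partition_big (@rvR _ _ _) (fun r => (F r z)%:num <= b)) /=.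
  apply: eq_bigr => r Fr; apply: eq_bigl => w; rewrite xpair_eqE.
  have [rr|_] := eqVneq (rvR w) r; last by rewrite !andbF.
  have [zz|_] := eqVneq (rvZ w) z; last by rewrite !andbF.
  by rewrite rr zz Fr !andbT.
by move=> w /and4P[_ Fw /eqP <- _].
Qed.

(** On success [F <= b], so [mut <= b * q] there, and summing over [r] bounds the mass at each [d]
    by [b]. The factor [M z] undoes the conditioning on [ze]. *)
Lemma soft_UPE_truncation (eps' : {i01 K}) :
  is_soft_UPE D H eps' F -> H mu -> 0 <= b ->
  exists g : TZ -> TD -> K,
  [/\ forall z d, 0 <= g z d,
      forall z d, g z d <= success_law mu b z e d,
      forall z d, g z d <= M z * b
    & \sum_z (weight (success_law mu b z e) - weight (g z)) <=
      eps'%:num * Prob mu (fun w => rvE w == e)].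
Proof.
move=> hF Hmu b0; set pe := Prob mu _.
have pe_ge0 : 0 <= pe by apply/Prob_ge0/pmf_ge0.
(* The soft UPE condition says nothing about an [e] of probability zero, where all weights vanish
   and [g = 0] suffices. *)
have [pe0|pen0] := eqVneq pe 0.
  exists (fun _ _ => 0); split=> // [z d|z d|].
  - by apply: law_ge0; apply/restrict_ge0/pmf_ge0.
  - exact: mulr_ge0.
  rewrite pe0 mulr0; apply: (@le_trans _ _ pe); last by rewrite pe0.
  rewrite /pe -sum_M; apply: ler_sum => z _.
  by rewrite {2}/weight big1 // subr0 weight_success_law_le.
have pe_gt0 : 0 < pe by rewrite lt_neqAle eq_sym pen0.
have [mut [mut_sub mut_le mut_w [q mut_q]]] := hF e mu Hmu pe_gt0.
have mut_ge0 z x : 0 <= mut z x by case: (mut_sub z).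
have MmutJ z x : M z * mut z x <= J z x.
  (* When [ze] has probability zero, [mut z] is not bounded by a conditional law, but the factor
     [M z] removes it. *)
  have [Mz|Mz] := eqVneq (M z) 0; first by rewrite Mz mul0r Prob_ge0 //; apply: pmf_ge0.
  have Mp : 0 < M z by rewrite lt_neqAle eq_sym Mz M_ge0.
  by rewrite mulrC -ler_pdivlMr //; apply: mut_le.
exists (fun z d => M z * \sum_(r | (F r z)%:num <= b) mut z (d, r)).
split=> [z d|z d|z d|].
- by rewrite mulr_ge0 // sumr_ge0.
- by rewrite success_lawE mulr_sumr; apply: ler_sum.
- rewrite ler_wpM2l // (@le_trans _ _ (\sum_(r | (F r z)%:num <= b) b * q d z r)) //.
    apply: ler_sum => r Fr; apply: (le_trans (mut_q _ _ _)).
    by rewrite ler_wpM2r // pmf_ge0.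
  rewrite -mulr_sumr ler_piMr // -(pmf_sum1 (q d z)) big_mkcond /=.
  by apply: ler_sum => r _; case: ifP => // _; apply: pmf_ge0.
apply: (@le_trans _ _ (\sum_z (M z - M z * weight (mut z)))).
  apply: ler_sum => z _.
  (* The mass lost on success is at most the mass lost over all [r], because every term is
     nonnegative by [MmutJ]. *)
  rewrite [leRHS](_ : _ = \sum_d \sum_r (J z (d, r) - M z * mut z (d, r))).
    rewrite /weight -sumrB; apply: ler_sum => d _.
    rewrite success_lawE mulr_sumr -sumrB [leLHS]big_mkcond /=.
    by apply: ler_sum => r _; case: ifP => // _; rewrite subr_ge0.
  rewrite pair_bigA /= sumrB /weight mulr_sumr; congr (_ - _).
    rewrite -[LHS](sum_Prob _ (fun w => (D (rvR w), rvR w))).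
    by apply: eq_bigr => -[].
  by apply: eq_bigr => -[].
rewrite sumrB sum_M -/pe.
(* Since [M z] is [pe] times the probability of [z] given [e], the weight condition on [mut] bounds
   the total loss. *)
have -> : \sum_z M z * weight (mut z) =
  pe * \sum_z weight (mut z) * claw mu (@rvZ _ _ _) (fun w => rvE w == e) z.
  rewrite mulr_sumr; apply: eq_bigr => z _.
  by rewrite /claw -/(M z) -/pe mulrC [RHS]mulrCA; congr (_ * _); rewrite mulrC divfK.
rewrite -[X in X - _]mulr1 -mulrBr mulrC ler_wpM2r //.
by rewrite lerBlDr addrC -lerBlDr.
Qed.

End SoftUPE.

(** * Extractor error jointly with [Z] and [E] *)

Section Soundness.
Variables (K : realType) (TR TZ TE : finType) (n : nat) (D : TR -> bits n).
Variables (H : set (fdist K (TR * TZ * TE)%type)) (F : TR -> TZ -> {nonneg K}).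
Variables (Ext : strong_extractor K) (l sigma : nat) (tau epsx b : K).
Variable mu : fdist K (TR * TZ * TE)%type.

Let ext_seed (d : bits n) (s : bits l) := Ext n l tau sigma epsx d s.
Let success (w : TR * TZ * TE) := (F (rvR w) (rvZ w))%:num <= b.
Let zE (w : TR * TZ * TE) := (rvZ w, rvE w).

(** For each [z] the triangle inequality has three legs: truncation to [g z], extraction from [g z],
    and rescaling of the uniform law. The first and third each cost at most half the missing mass,
    so it is counted only once. *)
Lemma TV_extract_success (eps' : {i01 K}) (e : TE) : linear_extractor Ext ->
  ext_constraints Ext n l tau sigma epsx -> b + 2 `^ (- n%:R) <= 2 `^ (- tau) ->
  is_soft_UPE D H eps' F -> H mu -> 0 <= b ->
  \sum_z TV (law (indep (success_law D F mu b z e) (unif K (bits l)))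
               (fun t => (ext_seed t.1 t.2, t.2)))
            (fun t => weight (success_law D F mu b z e) *
               unif K (bits sigma * bits l)%type t)
  <= (eps'%:num + epsx) * Prob mu (fun w => rvE w == e).
Proof.
move=> hExt cExt hb hF Hmu b0.
have [g [g0 g_le g_b g_w]] := soft_UPE_truncation e hF Hmu b0.
pose M z := Prob mu (fun w => (rvZ w == z) && (rvE w == e)).
rewrite mulrDl; apply: (@le_trans _ _ (\sum_z
  ((weight (success_law D F mu b z e) - weight (g z)) + M z * epsx))); last first.
  rewrite big_split /= lerD // -mulr_suml mulrC /M.
  by rewrite (sum_Prob mu (@rvZ _ _ _) (fun w => rvE w == e)).
apply: ler_sum => z _; set a := success_law D F mu b z e.
have gwM : weight (g z) <= M z.
  apply: le_trans (weight_success_law_le D F mu b e z).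
  by apply: ler_sum => d _; apply: g_le.
have u0 m (x : bits m) : 0 <= unif K (bits m) x by rewrite invr_ge0 ler0n.
have cG : (0 < #|{: bits sigma * bits l}|)%N.
  by rewrite card_prod muln_gt0 !card_bits_gt0.
have U0 (x : bits sigma * bits l) : 0 <= unif K (bits sigma * bits l)%type x.
  by rewrite invr_ge0 ler0n.
have t1 : TV (law (indep a (unif K (bits l))) (fun t => (ext_seed t.1 t.2, t.2)))
    (law (indep (g z) (unif K (bits l))) (fun t => (ext_seed t.1 t.2, t.2)))
    <= 2^-1 * (weight a - weight (g z)).
  apply: (le_trans (TV_law_le _ _ _)); rewrite TV_indep // sum_unif ?card_bits_gt0 //.
  by rewrite mulr1 TV_le // => d; apply: g_le.
have t2 := extract_submeasure hExt cExt (g0 z) gwM (g_b z) hb.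
have t3 : TV (fun t => weight (g z) * unif K (bits sigma * bits l)%type t)
    (fun t => weight a * unif K (bits sigma * bits l)%type t)
    = 2^-1 * (weight a - weight (g z)).
  have wga : weight (g z) <= weight a by apply: ler_sum => d _; apply: g_le.
  rewrite /TV; congr (_ * _); rewrite -[RHS]mulr1 -(sum_unif _ cG) mulr_sumr.
  by apply: eq_bigr => x _; rewrite distrC -mulrBl normrM !ger0_norm ?subr_ge0.
have := TV_triangle (law (indep a (unif K (bits l))) (fun t => (ext_seed t.1 t.2, t.2)))
  (law (indep (g z) (unif K (bits l))) (fun t => (ext_seed t.1 t.2, t.2)))
  (fun t => weight a * unif K (bits sigma * bits l)%type t).
have := TV_triangle
  (law (indep (g z) (unif K (bits l))) (fun t => (ext_seed t.1 t.2, t.2)))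
  (fun t => weight (g z) * unif K (bits sigma * bits l)%type t)
  (fun t => weight a * unif K (bits sigma * bits l)%type t).
rewrite t3; move: t1 t2; rewrite /ext_seed.
set T1 := TV _ _; set T2 := TV _ _; set T3 := TV _ _; set T4 := TV _ _.
move: T1 T2 T3 T4 => T1 T2 T3 T4; lra.
Qed.

Lemma law_extract_success :
  law (indep (restrict mu success) (unif K (bits l)))
    (fun w => (ext_seed (D (rvR w.1)) w.2, w.2, zE w.1)) =1
  fun t => law (indep (success_law D F mu b t.2.1 t.2.2) (unif K (bits l)))
    (fun u => (ext_seed u.1 u.2, u.2)) t.1.
Proof.
case=> [[x s] [z e]] /=; rewrite law_indep_pair /success_law law_comp.
(* The seed is moved to the last coordinate, where [law_indep_pair] can split it off. *)
transitivity (law (indep (restrict mu success) (unif K (bits l)))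
    (fun w => ((ext_seed (D (rvR w.1)) w.2, zE w.1), w.2)) ((x, (z, e)), s)).
  by apply: eq_bigl => w; rewrite !xpair_eqE andbAC.
rewrite (law_indep_pair _ _ (fun w s => (ext_seed (D (rvR w)) s, zE w))).
congr (_ * _); rewrite !law_restrict; apply: eq_Prob => w /=.
by rewrite !xpair_eqE -andbA [success w && _]andbC.
Qed.

Lemma weight_success_law_zE z e :
  weight (success_law D F mu b z e) = law (restrict mu success) zE (z, e).
Proof.
rewrite weight_success_law law_restrict; apply: eq_Prob => w.
by rewrite xpair_eqE andbC.
Qed.

(** The soft UPE acts on each [e] separately; the resulting errors are proportional to the
    probability of [e], and these probabilities sum to 1. *)
Lemma TV_extract_zE (eps' : {i01 K}) : linear_extractor Ext ->
  ext_constraints Ext n l tau sigma epsx -> b + 2 `^ (- n%:R) <= 2 `^ (- tau) ->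
  is_soft_UPE D H eps' F -> H mu -> 0 <= b ->
  TV (law (indep (restrict mu success) (unif K (bits l)))
        (fun w => (ext_seed (D (rvR w.1)) w.2, w.2, zE w.1)))
     (indep (indep (unif K (bits sigma)) (unif K (bits l)))
        (law (restrict mu success) zE)) <= eps'%:num + epsx.
Proof.
move=> hExt cExt hb hF Hmu b0.
rewrite (eq_TV law_extract_success (q' := fun t =>
  weight (success_law D F mu b t.2.1 t.2.2) * unif K (bits sigma * bits l)%type t.1));
  last first.
  by move=> [[x s] [z e]] /=; rewrite unif_indep weight_success_law_zE mulrC.
rewrite TV_prod /= -(pair_bigA _ (fun z e => TV (fun a =>
  law (indep (success_law D F mu b z e) (unif K (bits l)))
    (fun u => (ext_seed u.1 u.2, u.2)) a) (fun a =>
  weight (success_law D F mu b z e) * unif K (bits sigma * bits l)%type a))) /=.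
rewrite exchange_big /=.
apply: (@le_trans _ _ (\sum_e (eps'%:num + epsx) * Prob mu (fun w => rvE w == e))).
  by apply: ler_sum => e _; apply: TV_extract_success.
by rewrite -mulr_sumr (sum_law mu (@rvE _ _ _)) pmf_sum1 mulr1.
Qed.

End Soundness.

(** Beyond [TV_extract_zE], it remains to pass from vectors to strings, from [L] source bits to
    their prefix, and from conditioning to restriction. *)
Theorem theorem21 (K : realType) (TR TZ TE : finType) (n : nat)
    (D : TR -> bits n) (H : set (fdist K (TR * TZ * TE)%type))
    (U : TR -> TZ -> {i01 K} -> {nonneg K})
    (hU : soft_UPE D H U)
    (sigma : nat) (hsigma : (0 < sigma)%N) (eps : K) (heps : 0 < eps)
    (Ext : strong_extractor K) (hExt : linear_extractor Ext)
    (sigmah : K) (epsh : {i01 K}) (epsx : K) (l : nat)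
    (hparams : Qparams Ext n sigma eps sigmah epsh epsx l)
    (L : nat) (lL : (l <= L)%N) :
  sound H (fun w => (rvZ w, rvE w)) eps
    (protocolQ D U Ext sigma sigmah epsh epsx lL).
Proof.
case: hparams => _ _ cExt eps_split _.
have hF := hU.2 epsh; set F := (F in is_soft_UPE _ _ _ F) in hF.
pose b : K := 2 `^ (- sigmah).
set Q := protocolQ D U Ext sigma sigmah epsh epsx lL.
move=> mu Hmu.
pose P := indep mu (unif K (bits L)).
pose run (w : TR * TZ * TE * bits L) := Q (rvR w.1) (rvZ w.1) w.2.
pose success w := outP (run w).
pose succ (w : TR * TZ * TE) := (F (rvR w) (rvZ w))%:num <= b.
pose zE (w : TR * TZ * TE) := (rvZ w, rvE w).
change ((forall w, success w -> size (outX (run w)) = sigma) /\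
  exists nu : fdist K (TZ * TE)%type,
    TV (claw P (fun w => (outX (run w), outS (run w), zE w.1)) success)
       (indep (indep (unif_string K sigma) (unif_string K l)) nu)
    * Prob P success <= eps).
have successE w : success w = succ w.1.
  by rewrite /success /run /Q /protocolQ /succ /F leNgt; case: ifP.
have runE w : succ w.1 -> outX (run w) = string_of (Ext n l (Qtau n sigmah) sigma
      epsx (D (rvR w.1)) (prefix_bits lL w.2)) /\
    outS (run w) = string_of (prefix_bits lL w.2).
  by rewrite /run /Q /protocolQ /succ /F leNgt => /negbTE ->.
split=> [w|].
  by rewrite successE => /runE[-> _]; rewrite size_string_of.
(* Success is decided by [r] and [z] alone, so the source bits integrate to 1. *)
have PE : Prob P success = Prob mu succ.
  rewrite -!sum_restrict -[RHS]mulr1 -(sum_unif _ (card_bits_gt0 L)) -sum_indep.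
  apply: eq_bigr => w _; rewrite /restrict successE /P /indep.
  by case: ifP; rewrite ?mul0r.
(* If success has probability zero, any [nu] works; the unconditional law of [ZE] is taken. *)
have [k0|kn0] := eqVneq (Prob mu succ) 0.
  have nu0 : forall x, 0 <= law mu zE x by apply: law_ge0; apply: pmf_ge0.
  have nu1 : \sum_x law mu zE x = 1 by rewrite sum_law pmf_sum1.
  by exists (FDist nu0 nu1); rewrite PE k0 mulr0 ltW.
exists (FDist (claw_ge0 zE succ (@pmf_ge0 _ _ mu)) (claw_sum1 zE kn0)).
have k_ge0 : 0 <= Prob mu succ by apply/Prob_ge0/pmf_ge0.
rewrite PE TVZr // -eps_split.
have hb : b + 2 `^ (- n%:R) <= 2 `^ (- Qtau n sigmah) by rewrite powR_Qtau.
have main := TV_extract_zE hExt cExt hb hF Hmu (powR_ge0 _ _).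
apply: le_trans main; pose str (t : bits sigma * bits l * (TZ * TE)) :=
  ((string_of t.1.1, string_of t.1.2), t.2).
(* Encoding vectors as strings is a map applied to both laws, so it cannot increase the distance. *)
apply: le_trans (TV_law_le _ _ str).
rewrite le_eqVlt; apply/orP; left; apply/eqP/eq_TV => x; last first.
  rewrite (law_indep _ _ (fun u => (string_of u.1, string_of u.2)) id) /indep.
  by rewrite law_indep /indep !law_string_of /= -mulrA clawM // law_id.
rewrite -PE clawM ?PE // law_comp.
(* The uniform [l]-bit seed is realised as the prefix of the [L] source bits. *)
rewrite -(eq_law (p := law (indep (restrict mu succ) (unif K (bits L)))
  (fun w => (w.1, prefix_bits lL w.2))) (X := str \o (fun w =>
  ((Ext n l (Qtau n sigmah) sigma epsx (D (rvR w.1)) w.2, w.2), zE w.1)))) //; last first.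
  by move=> w; rewrite (law_indep _ _ id) /indep law_prefix_bits law_id.
(* The two outputs differ on failure, where the protocol returns empty strings, but that event
   carries no restricted mass. *)
rewrite law_comp; apply: eq_law_support => w.
  by rewrite /restrict successE /P /indep; case: ifP; rewrite ?mul0r.
rewrite /indep /restrict; case: ifP => [/runE[-> ->] //|_].
by rewrite mul0r eqxx.
Qed.
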